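(* Let $R$ be a commutative ring, let $\underline{f}=f_1,\ldots,f_r$ be a covering sequence of $R$, let $\underline{x}=x_1,\ldots,x_k$ be an ordered sequence of elements of $R$, and let $M$ be an $R$-module. The following conditions are equivalent. (i) $\underline{x}$ is $M$-weakly proregular (resp. $M$-proregular). (ii) The image $\underline{x}/1 = x_1/1,\ldots,x_k/1$ of $\underline{x}$ in $R_{f_i}$ is $M_{f_i}$-weakly proregular (resp. $M_{f_i}$-proregular) for all $i=1,\ldots,r$. (That is, the equivalence holds for weak proregularity, and it also holds for proregularity.)
   Context: Covering sequence: a sequence $f_1,\ldots,f_r$ of elements of $R$ with $\operatorname{Spec}R=\bigcup_{i=1}^r D(f_i)$, where $D(f)=\operatorname{Spec}R\setminus V(f)$; equivalently $(f_1,\ldots,f_r)R=R$. Proregular: $x_1,\ldots,x_k$ is $M$-proregular if for every $i=1,\ldots,k$ and every positive integer $n$ there is an integer $m\ge n$ such that the map $$(x_1^m,\ldots,x_{i-1}^m)M :_M x_i^m/(x_1^m,\ldots,x_{i-1}^m)M \xrightarrow{\ x_i^{m-n}\ } (x_1^n,\ldots,x_{i-1}^n)M :_M x_i^n/(x_1^n,\ldots,x_{i-1}^n)M$$ induced by multiplication by $x_i^{m-n}$ is zero. Here $N:_M y = \{u\in M : yu\in N\}$; for $i=1$ the submodule $(x_1^m,\ldots,x_{i-1}^m)M$ is $0$. Weakly proregular: write $\underline{x}^{(n)}=x_1^n,\ldots,x_k^n$ and let $H_i(\underline{x}^{(n)};M)$ be the homology of the Koszul complex $K_\bullet(\underline{x}^{(n)};M)$.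 For $m\ge n$ there is a natural map of Koszul complexes $K_\bullet(\underline{x}^{(m)};M)\to K_\bullet(\underline{x}^{(n)};M)$, the tensor product over $j$ of the maps $K_\bullet(x_j^m)\to K_\bullet(x_j^n)$ which are the identity in degree $0$ and multiplication by $x_j^{m-n}$ in degree $1$. The sequence $\underline{x}$ is $M$-weakly proregular if for all $i>0$ and every positive integer $n$ there is an integer $m\ge n$ such that the induced map $H_i(\underline{x}^{(m)};M)\to H_i(\underline{x}^{(n)};M)$ is zero. *)

(* Defs.v *)
From HB Require Import structures.
From mathcomp Require Import all_boot all_order all_algebra.
From mathcomp Require Import boolp classical_sets.
From mathcomp Require Import zify.

Set Implicit Arguments.
Unset Strict Implicit.
Unset Printing Implicit Defensive.

Import GRing.Theory.

Local Open Scope ring_scope.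
Local Open Scope quotient_scope.

(* Rings are comPzRingType: commutative, with unit, possibly zero.  The zero   *)
(* ring must be allowed, since R_f is zero as soon as f is nilpotent.          *)

(* Prime spectrum and covering sequences.  The library's prime_idealr is only  *)
(* available over nonzero rings.                                               *)

Section Spectrum.
Local Open Scope classical_set_scope.
Variable R : comPzRingType.

Definition prime_ideal (P : set R) : Prop :=
  [/\ P 0 /\ (forall u v, P u -> P v -> P (u + v)),
      forall a u, P u -> P (a * u),
      ~ P 1
    & forall u v, P (u * v) -> P u \/ P v].

Definition Spec : set (set R) := [set P | prime_ideal P].
Definition vanishing_locus (a : R) : set (set R) := [set P | Spec P /\ P a].
Definition basic_open (a : R) : set (set R) := Spec `\` vanishing_locus a.

Definition covering_sequence (r : nat) (f : 'I_r -> R) : Prop :=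
  Spec = \bigcup_(i in [set: 'I_r]) basic_open (f i).

End Spectrum.

(* Quotient modules V / N, and subquotients Z / B of V.  The inclusion of B in *)
(* Z is not required by the definition (Z / B is Z modulo its intersection     *)
(* with B), but it holds in both uses below: see sub_colonmod and              *)
(* koszul_boundaries_cycles.                                                   *)

Section QuotientModule.
Variables (R : pzRingType) (V : lmodType R) (N : submodClosed V).

(* N as an additive subgroup, to which the library's Quotient.quot applies.    *)
Definition submod_group : {pred V} := N.
Fact submod_group_closed : zmod_closed submod_group.
Proof. exact: GRing.submod_closedB (submodClosedP N). Qed.
HB.instance Definition _ :=
  GRing.isZmodClosed.Build V submod_group submod_group_closed.

Definition quotmod : Type := Quotient.quot submod_group.
HB.instance Definition _ := GRing.Zmodule.on quotmod.

Definition quot_class (u : V) : quotmod := \pi_(Quotient.quot submod_group) u.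

Lemma quot_classP u v : quot_class u = quot_class v <-> u - v \in N.
Proof.
rewrite /quot_class; split=> [/eqP|h]; last apply/eqP;
by rewrite -Quotient.idealrBE.
Qed.

Lemma quot_class_repr (q : quotmod) : quot_class (repr q) = q.
Proof. exact: reprK. Qed.

Lemma quot_class_is_zmod_morphism : zmod_morphism quot_class.
Proof. by move=> u v; rewrite /quot_class !piE. Qed.
HB.instance Definition _ :=
  GRing.isZmodMorphism.Build V quotmod quot_class quot_class_is_zmod_morphism.

Definition quot_scale (a : R) (q : quotmod) : quotmod :=
  quot_class (a *: repr q).

Lemma quot_scale_class a u : quot_scale a (quot_class u) = quot_class (a *: u).
Proof.
apply/quot_classP; rewrite -scalerBr rpredZ //.
by apply/quot_classP; rewrite quot_class_repr.
Qed.

Fact quot_scaleA a b q : quot_scale a (quot_scale b q) = quot_scale (a * b) q.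
Proof. by rewrite -[q]quot_class_repr !quot_scale_class scalerA. Qed.
Fact quot_scale1 : left_id 1 quot_scale.
Proof. by move=> q; rewrite -[q]quot_class_repr quot_scale_class scale1r. Qed.
Fact quot_scaleDr : right_distributive quot_scale +%R.
Proof.
move=> a p q; rewrite -[p]quot_class_repr -[q]quot_class_repr.
by rewrite -raddfD !quot_scale_class scalerDr raddfD.
Qed.
Fact quot_scaleDl q : {morph quot_scale^~ q : a b / a + b}.
Proof.
by move=> a b; rewrite -[q]quot_class_repr !quot_scale_class scalerDl raddfD.
Qed.
HB.instance Definition _ := GRing.Zmodule_isLmodule.Build R quotmod
  quot_scaleA quot_scale1 quot_scaleDr quot_scaleDl.

End QuotientModule.

Section Subquotient.
Variables (R : pzRingType) (V : lmodType R).

Definition submod (Z : submodClosed V) : Type := {u : V | u \in Z}.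
HB.instance Definition _ (Z : submodClosed V) := SubType.on (submod Z).
HB.instance Definition _ (Z : submodClosed V) := [Choice of submod Z by <:].
HB.instance Definition _ (Z : submodClosed V) :=
  [SubChoice_isSubLmodule of submod Z by <:].

Definition subin (Z B : submodClosed V) : {pred submod Z} :=
  fun z => val z \in B.
Arguments subin : clear implicits.
Lemma subinE Z B z : (z \in subin Z B) = (val z \in B).
Proof. by []. Qed.
Fact subin_closed Z B : subsemimod_closed (subin Z B).
Proof.
split=> [|a u]; last by rewrite !subinE => uB; rewrite linearZ_LR rpredZ.
split=> [|u v]; rewrite !subinE ?raddf0 ?rpred0 // => uB vB.
by rewrite raddfD rpredD.
Qed.
HB.instance Definition _ Z B :=
  GRing.isSubmodClosed.Build R (submod Z) (subin Z B) (subin_closed Z B).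

Definition subquot (Z B : submodClosed V) : Type := quotmod (subin Z B).
HB.instance Definition _ (Z B : submodClosed V) := GRing.Lmodule.on (subquot Z B).

Definition subquot_class (Z B : submodClosed V) (z : submod Z) : subquot Z B :=
  quot_class (subin Z B) z.

End Subquotient.
Arguments subin {R V} Z B _.

(* The map Z / B -> Z' / B' induced by a linear map g with g(Z) in Z' and      *)
(* g(B) in B'; subquot_map_class below is its defining property.               *)

Section InducedMap.
Variables (R : pzRingType) (V W : lmodType R) (g : {linear V -> W}).
Variables (Z B : submodClosed V) (Z' B' : submodClosed W).
Hypotheses (gZ : forall u, u \in Z -> g u \in Z').
Hypotheses (gB : forall u, u \in B -> g u \in B').

Definition submod_map (z : submod Z) : submod Z' :=
  Sub (g (val z)) (gZ (valP z)).

Definition subquot_map of (forall u, u \in B -> g u \in B') :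
    subquot Z B -> subquot Z' B' :=
  fun q => subquot_class B' (submod_map (repr q)).

Lemma subquot_map_class z :
  subquot_map gB (subquot_class B z) = subquot_class B' (submod_map z).
Proof.
apply/quot_classP; rewrite subinE raddfB /= -raddfB gB //.
have /quot_classP : quot_class (subin Z B) (repr (subquot_class B z)) =
                    quot_class (subin Z B) z by exact: quot_class_repr.
by rewrite subinE raddfB.
Qed.

End InducedMap.

Section KernelImage.
Variables (R : pzRingType) (V W : lmodType R) (g : {linear V -> W}).

Definition kermod : {pred V} := fun u => g u == 0.
Lemma kermodE u : (u \in kermod) = (g u == 0).
Proof. by []. Qed.
Fact kermod_closed : subsemimod_closed kermod.
Proof.
split=> [|a u]; last first.
  rewrite !kermodE => /eqP gu; apply/eqP.
  by rewrite linearZ_LR -[RHS](scaler0 _ a); congr (_ *: _).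
split=> [|u v]; rewrite !kermodE ?raddf0 // => /eqP gu /eqP gv.
by rewrite linearD [g u]gu [g v]gv addr0.
Qed.
HB.instance Definition _ := GRing.isSubmodClosed.Build R V kermod kermod_closed.

Definition immod : {pred W} := fun w => `[< exists v, w = g v >].
Fact immod_closed : subsemimod_closed immod.
Proof.
split=> [|a u]; last first.
  rewrite !unfold_in => /asboolP [v ->]; apply/asboolP.
  by exists (a *: v); rewrite linearZ_LR.
split=> [|u v]; rewrite !unfold_in.
  by apply/asboolP; exists 0; rewrite raddf0.
move=> /asboolP [u' ->] /asboolP [v' ->]; apply/asboolP.
by exists (u' + v'); rewrite raddfD.
Qed.
HB.instance Definition _ := GRing.isSubmodClosed.Build R W immod immod_closed.

End KernelImage.

(* Proregular sequences.  For i : 'I_k (0-based), seqmod y i M is the          *)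
(* submodule (y_0, ..., y_(i-1)) M.                                            *)

Section Proregular.
Variables (R : comPzRingType) (k : nat) (M : lmodType R).

Definition seqmod (y : 'I_k -> R) (i : 'I_k) : {pred M} :=
  fun u => `[< exists v : 'I_k -> M, u = \sum_(j < k | (j < i)%N) y j *: v j >].
Fact seqmod_closed y i : subsemimod_closed (seqmod y i).
Proof.
split=> [|a u]; last first.
  rewrite !unfold_in => /asboolP [v ->]; apply/asboolP.
  exists (fun j => a *: v j); rewrite scaler_sumr; apply: eq_bigr => j _.
  by rewrite !scalerA mulrC.
split=> [|u v]; rewrite !unfold_in.
  by apply/asboolP; exists (fun=> 0); rewrite big1 // => j _; rewrite scaler0.
move=> /asboolP [u' ->] /asboolP [v' ->]; apply/asboolP.
exists (fun j => u' j + v' j); rewrite -big_split /=.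
by apply: eq_bigr => j _; rewrite scalerDr.
Qed.
HB.instance Definition _ y i :=
  GRing.isSubmodClosed.Build R M (seqmod y i) (seqmod_closed y i).

Definition colonmod (N : submodClosed M) (a : R) : {pred M} :=
  fun u => a *: u \in N.
Lemma colonmodE N a u : (u \in colonmod N a) = (a *: u \in N).
Proof. by []. Qed.
Fact colonmod_closed N a : subsemimod_closed (colonmod N a).
Proof.
split=> [|b u]; last first.
  by rewrite !colonmodE => uN; rewrite scalerA mulrC -scalerA rpredZ.
split=> [|u v]; rewrite !colonmodE ?scaler0 ?rpred0 // => uN vN.
by rewrite scalerDr rpredD.
Qed.
HB.instance Definition _ N a :=
  GRing.isSubmodClosed.Build R M (colonmod N a) (colonmod_closed N a).

Lemma sub_colonmod (N : submodClosed M) a : {subset N <= colonmod N a}.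
Proof. by move=> u uN; rewrite colonmodE rpredZ. Qed.

Definition powseq (x : 'I_k -> R) (n : nat) : 'I_k -> R := fun j => x j ^+ n.

Variable x : 'I_k -> R.

Definition colon_quot (n : nat) (i : 'I_k) : Type :=
  subquot (colonmod (seqmod (powseq x n) i) (x i ^+ n))
          (seqmod (powseq x n) i).
HB.instance Definition _ n i := GRing.Lmodule.on (colon_quot n i).

Section Transition.
Variables (n m : nat) (i : 'I_k).
Hypothesis le_nm : (n <= m)%N.

Fact seqmod_mono u :
  u \in seqmod (powseq x m) i -> u \in seqmod (powseq x n) i.
Proof.
rewrite !unfold_in => /asboolP [v ->]; apply/asboolP.
exists (fun j => x j ^+ (m - n) *: v j); apply: eq_bigr => j _.
by rewrite scalerA -exprD subnKC.
Qed.

Fact colon_mult_num u : u \in colonmod (seqmod (powseq x m) i) (x i ^+ m) ->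
  x i ^+ (m - n) *: u \in colonmod (seqmod (powseq x n) i) (x i ^+ n).
Proof.
move=> uN; rewrite colonmodE scalerA -exprD subnKC //.
exact: seqmod_mono.
Qed.

Fact colon_mult_den u : u \in seqmod (powseq x m) i ->
  x i ^+ (m - n) *: u \in seqmod (powseq x n) i.
Proof. by move=> uN; rewrite rpredZ // seqmod_mono. Qed.

Definition colon_quot_map : colon_quot m i -> colon_quot n i :=
  subquot_map (g := *:%R (x i ^+ (m - n))) colon_mult_num colon_mult_den.

End Transition.

Definition proregular : Prop :=
  forall (i : 'I_k) (n : nat), (0 < n)%N ->
  exists (m : nat) (le_nm : (n <= m)%N),
  forall q : colon_quot m i, colon_quot_map le_nm q = 0.

End Proregular.

(* The Koszul complex K(y; M).  Its degree p part is the direct sum of copies  *)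
(* of M indexed by the p-element subsets T of 'I_k: an element u stands for    *)
(* the sum of the e_T (x) u_T, where e_T is the exterior product of the e_j    *)
(* (j in T, in increasing order), and                                          *)
(*   d (e_T (x) u) = sum_(j in T) (-1)^#{i in T, i < j} e_(T - j) (x) y_j u.   *)
(* In degree 0 only T empty occurs and the inner sum is empty: the             *)
(* differential of degree 0 is zero, and its target 0.-1 = 0 is immaterial.    *)

Section Koszul.
Variables (R : comPzRingType) (k : nat).

Local Notation koszul_index p := {T : {set 'I_k} | #|T| == p}.

Definition koszul (M : lmodType R) (p : nat) : Type :=
  {ffun koszul_index p -> M}.
HB.instance Definition _ M p := GRing.Lmodule.on (koszul M p).

Variable M : lmodType R.

Definition koszul_sign (T : {set 'I_k}) (j : 'I_k) : R :=
  (-1) ^+ #|[set i in T | (i < j)%N]|.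

Definition koszul_diff (y : 'I_k -> R) (p : nat) (u : koszul M p) :
    koszul M p.-1 :=
  [ffun S => \sum_(T : koszul_index p)
     \sum_(j in val T | val T :\ j == val S)
       (koszul_sign (val T) j * y j) *: u T].

Fact koszul_diff_linear y p : linear (@koszul_diff y p).
Proof.
move=> a u v; apply/ffunP => S; rewrite !ffunE scaler_sumr -big_split /=.
apply: eq_bigr => T _; rewrite scaler_sumr -big_split /=.
apply: eq_bigr => j _; rewrite !ffunE scalerDr !scalerA; congr (_ *: _ + _).
by rewrite mulrC.
Qed.
HB.instance Definition _ y p := GRing.isLinear.Build R (koszul M p)
  (koszul M p.-1) *:%R (@koszul_diff y p) (@koszul_diff_linear y p).

Lemma sum_antisym (V : zmodType) (F : 'I_k -> 'I_k -> V) :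
  (forall i, F i i = 0) -> (forall i j : 'I_k, (i < j)%N -> F j i = - F i j) ->
  \sum_i \sum_j F i j = 0.
Proof.
move=> F0 FN.
have split_sum i : \sum_j F i j =
    \sum_(j < k | (i < j)%N) F i j + \sum_(j < k | (j < i)%N) F i j.
  rewrite (bigID (fun j : 'I_k => (i < j)%N)) /=; congr (_ + _).
  rewrite (bigID (fun j : 'I_k => (j < i)%N)) /= [X in _ + X]big1 ?addr0.
    by apply: eq_bigl => j; case: ltngtP.
  by move=> j; case: ltngtP => //= /val_inj <- _.
rewrite (eq_bigr _ (fun i _ => split_sum i)) big_split /=.
rewrite [X in _ + X](exchange_big_dep xpredT) //= -big_split big1 //= => i _.
rewrite -big_split big1 //= => j /FN ->.
by rewrite subrr.
Qed.

Lemma koszul_sign_swap (U : {set 'I_k}) (i j : 'I_k) : i \in U -> (i < j)%N ->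
  koszul_sign (U :\ j) i * koszul_sign U j =
  - (koszul_sign (U :\ i) j * koszul_sign U i).
Proof.
move=> iU ij; rewrite /koszul_sign.
have -> : [set l in U :\ j | (l < i)%N] = [set l in U | (l < i)%N].
  apply/setP => l; rewrite !inE; case: (l =P j) => //= ->.
  by rewrite ltnNge (ltnW ij) andbF.
have -> : #|[set l in U | (l < j)%N]| = #|[set l in U :\ i | (l < j)%N]|.+1.
  rewrite (cardsD1 i) inE iU ij add1n; congr (_.+1); apply: eq_card => l.
  by rewrite !inE andbA.
by rewrite exprS mulN1r mulrN mulrC.
Qed.

Lemma koszul_diffK y p (u : koszul M p) : koszul_diff y (koszul_diff y u) = 0.
Proof.
apply/ffunP => S; rewrite !ffunE.
pose a (T : {set 'I_k}) j := koszul_sign T j * y j.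
pose F (U : koszul_index p) l j := if [&& l \in val U, j \in val U :\ l
  & val U :\ l :\ j == val S] then (a (val U :\ l) j * a (val U) l) *: u U else 0.
transitivity (\sum_(U : koszul_index p) \sum_l \sum_j F U l j); last first.
  apply: big1 => U _; apply: sum_antisym => [i|i j ij]; rewrite /F.
    by rewrite !inE eqxx /= andbF.
  have nij : (i == j) = false by rewrite -val_eqE /= ltn_eqF.
  rewrite !inE [j == i]eq_sym nij /=.
  have -> : val U :\ j :\ i = val U :\ i :\ j.
    by apply/setP => l; rewrite !inE andbCA.
  case: (boolP (i \in val U)) => iU; last by rewrite andbF /= oppr0.
  case: (j \in val U) => //=; last by rewrite oppr0.
  case: ifP => _; last by rewrite oppr0.
  rewrite -scaleNr /a; congr (_ *: _).
  rewrite mulrACA koszul_sign_swap // [y i * _]mulrC mulNr.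
  by rewrite -mulrACA.
under eq_bigr => T _.
  under eq_bigr => j _.
    rewrite ffunE scaler_sumr.
    under eq_bigr do rewrite scaler_sumr.
    over.
  rewrite exchange_big /=.
  under eq_bigr do rewrite exchange_big /=.
  over.
rewrite exchange_big /=; apply: eq_bigr => U _.
rewrite (exchange_big_dep (mem (val U))) /=; last by move=> T l _ /andP[].
rewrite big_mkcond; apply: eq_bigr => l _; rewrite /F.
case: ifP => lU /=; last by rewrite big1.
have cardUl : #|val U :\ l| == p.-1.
  have /eqP/(congr1 predn) := valP U.
  by rewrite (cardsD1 l (val U)) lU add1n /= => ->.
rewrite (big_pred1 (exist _ (val U :\ l) cardUl)) => [|T]; last first.
  by rewrite lU /= eq_sym -val_eqE.
rewrite /= big_mkcond; apply: eq_bigr => j _.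
by case: ifP => _ //; rewrite scalerA.
Qed.

Definition koszul_cycles (y : 'I_k -> R) (p : nat) : submodClosed (koszul M p) :=
  kermod (koszul_diff y (p := p)).
Definition koszul_boundaries (y : 'I_k -> R) (p : nat) :
    submodClosed (koszul M p) :=
  immod (koszul_diff y (p := p.+1)).

Lemma koszul_boundaries_cycles y p :
  {subset koszul_boundaries y p <= koszul_cycles y p}.
Proof.
move=> u /asboolP [v ->]; rewrite kermodE; apply/eqP.
exact: (koszul_diffK y (p := p.+1) v).
Qed.

Definition koszul_homology (y : 'I_k -> R) (p : nat) : Type :=
  subquot (koszul_cycles y p) (koszul_boundaries y p).
HB.instance Definition _ y p := GRing.Lmodule.on (koszul_homology y p).

(* If y_j = c_j z_j for all j, the tensor product of the maps K(y_j) -> K(z_j) *)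
(* given by 1 in degree 0 and c_j in degree 1 maps e_T to the product of the   *)
(* c_j (j in T) times e_T.                                                     *)
Definition koszul_map (c : 'I_k -> R) (p : nat) (u : koszul M p) : koszul M p :=
  [ffun T : koszul_index p => (\prod_(j in val T) c j) *: u T].

Fact koszul_map_linear c p : linear (@koszul_map c p).
Proof.
move=> a u v; apply/ffunP => T; rewrite !ffunE scalerDr !scalerA.
by rewrite mulrC.
Qed.
HB.instance Definition _ c p := GRing.isLinear.Build R (koszul M p)
  (koszul M p) *:%R (@koszul_map c p) (@koszul_map_linear c p).

Lemma koszul_map_diff (c y z : 'I_k -> R) p (u : koszul M p) :
  (forall j, y j = c j * z j) ->
  koszul_map c (koszul_diff y u) = koszul_diff z (koszul_map c u).
Proof.
move=> yE; apply/ffunP => S; rewrite !ffunE scaler_sumr.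
apply: eq_bigr => T _; rewrite scaler_sumr.
apply: eq_bigr => j /andP[jT /eqP TjS]; rewrite ffunE !scalerA; congr (_ *: _).
rewrite [in RHS](big_setD1 j) //= TjS yE.
by rewrite mulrC -!mulrA; congr (_ * _); rewrite mulrCA mulrA.
Qed.
Lemma koszul_map_cycles (c y z : 'I_k -> R) p (u : koszul M p) :
  (forall j, y j = c j * z j) ->
  u \in koszul_cycles y p -> koszul_map c u \in koszul_cycles z p.
Proof.
move=> yE; rewrite !kermodE => /eqP uZ; apply/eqP.
by rewrite [LHS](esym (koszul_map_diff u yE)) [koszul_diff y u]uZ raddf0.
Qed.

Lemma koszul_map_boundaries (c y z : 'I_k -> R) p (u : koszul M p) :
  (forall j, y j = c j * z j) ->
  u \in koszul_boundaries y p -> koszul_map c u \in koszul_boundaries z p.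
Proof.
move=> yE /asboolP [v ->]; apply/asboolP; exists (koszul_map c v).
exact: (koszul_map_diff (p := p.+1) v yE).
Qed.

Variable x : 'I_k -> R.

Section Transition.
Variables (n m p : nat).
Hypothesis le_nm : (n <= m)%N.

Fact powseq_split j : powseq x m j = powseq x (m - n) j * powseq x n j.
Proof. by rewrite /powseq -exprD subnK. Qed.

Definition koszul_homology_map :
    koszul_homology (powseq x m) p -> koszul_homology (powseq x n) p :=
  subquot_map (g := koszul_map (powseq x (m - n)) (p := p))
    (fun u => koszul_map_cycles (u := u) powseq_split)
    (fun u => koszul_map_boundaries (u := u) powseq_split).

End Transition.

Definition weakly_proregular : Prop :=
  forall p : nat, (0 < p)%N -> forall n : nat, (0 < n)%N ->
  exists (m : nat) (le_nm : (n <= m)%N),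
  forall h : koszul_homology (powseq x m) p, koszul_homology_map le_nm h = 0.

End Koszul.

(* Localization at the powers of f: the class of (u, n) is the fraction        *)
(* u / f^n.  The localized ring R_f is the case M = R.                         *)

Section Localization.
Variables (R : comPzRingType) (f : R) (M : lmodType R).

Definition loc_rel (p q : M * nat) : bool :=
  `[< exists s, f ^+ s *: (f ^+ q.2 *: p.1) = f ^+ s *: (f ^+ p.2 *: q.1) >].

Let shift (u v : M) a b A B c :
  f ^+ a *: u = f ^+ b *: v -> A = (c + a)%N -> B = (c + b)%N ->
  f ^+ A *: u = f ^+ B *: v.
Proof. by move=> E -> ->; rewrite !exprD -!scalerA E. Qed.

Fact loc_rel_equiv : equiv_class_of loc_rel.
Proof.
split=> [p|p q|q p r]; first by apply/asboolP; exists 0.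
  by apply/asboolP/asboolP => -[s E]; exists s.
move=> /asboolP [s E] /asboolP [t F]; apply/asboolP; exists (s + t + q.2)%N.
move: E F; rewrite !scalerA -!exprD => E F.
rewrite (shift (c := t + r.2) E (B := s + p.2 + (t + r.2))); try lia.
by apply: (shift (c := s + p.2) F); lia.
Qed.
Canonical loc_equiv := EquivRelPack loc_rel_equiv.
Canonical loc_enc := defaultEncModRel loc_rel.

Definition loc : Type := {eq_quot loc_rel}.
HB.instance Definition _ := Choice.on loc.

Definition loc_frac (u : M) (n : nat) : loc := \pi_({eq_quot loc_rel}) (u, n).

Lemma loc_fracP u n v m : loc_frac u n = loc_frac v m <->
  exists s, f ^+ s *: (f ^+ m *: u) = f ^+ s *: (f ^+ n *: v).
Proof.
rewrite /loc_frac; split=> [/eqmodP /asboolP//|h].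
by apply/eqmodP/asboolP.
Qed.

Lemma loc_frac_repr (q : loc) : loc_frac (repr q).1 (repr q).2 = q.
Proof. by rewrite /loc_frac -surjective_pairing; exact: reprK. Qed.

Lemma loc_frac_ind (P : loc -> Prop) : (forall u n, P (loc_frac u n)) -> forall q, P q.
Proof. by move=> h q; rewrite -[q]loc_frac_repr. Qed.

Lemma loc_frac_eq u n v m : f ^+ m *: u = f ^+ n *: v -> loc_frac u n = loc_frac v m.
Proof. by move=> E; apply/loc_fracP; exists 0; rewrite E. Qed.

Definition loc_add (p q : loc) : loc :=
  loc_frac (f ^+ (repr q).2 *: (repr p).1 + f ^+ (repr p).2 *: (repr q).1)
       ((repr p).2 + (repr q).2).
Definition loc_opp (p : loc) : loc := loc_frac (- (repr p).1) (repr p).2.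

Lemma loc_add_frac u n v m :
  loc_add (loc_frac u n) (loc_frac v m) = loc_frac (f ^+ m *: u + f ^+ n *: v) (n + m).
Proof.
have /loc_fracP [s E] := loc_frac_repr (loc_frac u n).
have /loc_fracP [t F] := loc_frac_repr (loc_frac v m).
apply/loc_fracP; exists (s + t)%N; move: E F.
move: (repr _) (repr _) => [/= v' m'] [/= u' n'].
rewrite !scalerDr !scalerA -!exprD => E F; congr (_ + _).
  by apply: (shift (c := t + m + m') E); lia.
by apply: (shift (c := s + n + n') F); lia.
Qed.

Lemma loc_opp_frac u n : loc_opp (loc_frac u n) = loc_frac (- u) n.
Proof.
have /loc_fracP [s E] := loc_frac_repr (loc_frac u n).
by apply/loc_fracP; exists s; rewrite !scalerN E.
Qed.

Fact loc_addA : associative loc_add.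
Proof.
elim/loc_frac_ind => u n; elim/loc_frac_ind => v m; elim/loc_frac_ind => w l.
rewrite !loc_add_frac addnA; congr loc_frac.
by rewrite !scalerDr !scalerA -!exprD addrA [(l + m)%N]addnC [(l + n)%N]addnC.
Qed.
Fact loc_addC : commutative loc_add.
Proof.
elim/loc_frac_ind => u n; elim/loc_frac_ind => v m.
by rewrite !loc_add_frac addrC addnC.
Qed.
Fact loc_add0 : left_id (loc_frac 0 0) loc_add.
Proof.
by elim/loc_frac_ind => u n; rewrite loc_add_frac scaler0 add0r expr0 scale1r.
Qed.
Fact loc_addN : left_inverse (loc_frac 0 0) loc_opp loc_add.
Proof.
elim/loc_frac_ind => u n; rewrite loc_opp_frac loc_add_frac scalerN addNr.
by apply: loc_frac_eq; rewrite !scaler0.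
Qed.
HB.instance Definition _ :=
  GRing.isZmodule.Build loc loc_addA loc_addC loc_add0 loc_addN.

Lemma loc_fracD u n v m :
  loc_frac u n + loc_frac v m = loc_frac (f ^+ m *: u + f ^+ n *: v) (n + m).
Proof. exact: loc_add_frac. Qed.

End Localization.

Section LocalizedRing.
Variables (R : comPzRingType) (f : R).

Definition loc_ring : Type := loc f R^o.
HB.instance Definition _ := GRing.Zmodule.on loc_ring.

Section Action.
Variable M : lmodType R.

Definition loc_scale (p : loc_ring) (q : loc f M) : loc f M :=
  loc_frac f (((repr p).1 : R) *: (repr q).1) ((repr p).2 + (repr q).2).

Lemma loc_scale_frac (a : R^o) n (u : M) m :
  loc_scale (loc_frac f a n) (loc_frac f u m) = loc_frac f ((a : R) *: u) (n + m).
Proof.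
have /loc_fracP [s E] := loc_frac_repr (loc_frac f a n).
have /loc_fracP [t F] := loc_frac_repr (loc_frac f u m).
apply/loc_fracP; exists (s + t)%N; move: E F.
move: (repr _) (repr _) => [/= u' m'] [/= a' n'] E F.
have regroup i j (b : R) (v : M) : f ^+ (s + t) *: (f ^+ (i + j) *: (b *: v)) =
    (f ^+ s * (f ^+ i * b)) *: (f ^+ t *: (f ^+ j *: v)).
  rewrite !scalerA !exprD; congr (_ *: _).
  by rewrite -!mulrA [f ^+ t * (f ^+ i * _)]mulrCA [f ^+ t * (f ^+ j * b)]mulrA
     [_ * b]mulrC.
by rewrite !regroup F; congr (_ *: _).
Qed.

Fact loc_scale1 : left_id (loc_frac f (1 : R^o) 0) loc_scale.
Proof. by elim/loc_frac_ind => u n; rewrite loc_scale_frac scale1r. Qed.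

Fact loc_scaleDr : right_distributive loc_scale +%R.
Proof.
elim/loc_frac_ind => a n; elim/loc_frac_ind => u m; elim/loc_frac_ind => v l.
rewrite loc_fracD !loc_scale_frac loc_fracD; apply: loc_frac_eq.
rewrite !scalerDr !scalerA ![_ * (a : R) * _]mulrAC -!exprD.
by congr ((f ^+ _ * a) *: _ + (f ^+ _ * a) *: _); lia.
Qed.

Fact loc_scaleDl q : {morph loc_scale^~ q : p p' / p + p'}.
Proof.
elim/loc_frac_ind: q => u m; elim/loc_frac_ind => a n; elim/loc_frac_ind => b l /=.
rewrite loc_fracD !loc_scale_frac loc_fracD; apply: loc_frac_eq.
have regE i (c : R^o) : ((f ^+ i *: c : R^o) : R) *: u = f ^+ i *: ((c : R) *: u).
  by rewrite scalerA.
rewrite scalerDl !regE !scalerDr !scalerA -!exprD.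
by congr ((f ^+ _ * a) *: _ + (f ^+ _ * b) *: _); lia.
Qed.

End Action.

Fact loc_scaleA (M : lmodType R) (p q : loc_ring) (r : loc f M) :
  loc_scale p (loc_scale q r) = loc_scale (loc_scale p q : loc_ring) r.
Proof.
elim/loc_frac_ind: p => a n; elim/loc_frac_ind: q => b m; elim/loc_frac_ind: r => u l.
rewrite (loc_scale_frac b m u l) (loc_scale_frac a n) (loc_scale_frac a n b m).
by rewrite (loc_scale_frac _ _ u l) addnA; congr loc_frac; exact: scalerA.
Qed.

Definition loc_mul : loc_ring -> loc_ring -> loc_ring := @loc_scale R^o.

Fact loc_mulA : associative loc_mul.
Proof. exact: loc_scaleA. Qed.
Fact loc_mulC : commutative loc_mul.
Proof.
elim/loc_frac_ind => a n; elim/loc_frac_ind => b m.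
by rewrite /loc_mul !loc_scale_frac addnC; congr loc_frac; exact: mulrC.
Qed.
Fact loc_mul1 : left_id (loc_frac f (1 : R^o) 0) loc_mul.
Proof. exact: loc_scale1. Qed.
Fact loc_mulDl : left_distributive loc_mul +%R.
Proof. by move=> p p' q; exact: loc_scaleDl. Qed.
HB.instance Definition _ := GRing.Zmodule_isComPzRing.Build loc_ring
  loc_mulA loc_mulC loc_mul1 loc_mulDl.

HB.instance Definition _ (M : lmodType R) :=
  GRing.Zmodule_isLmodule.Build loc_ring (loc f M)
    (@loc_scaleA M) (@loc_scale1 M) (@loc_scaleDr M) (@loc_scaleDl M).

Lemma loc_fracM (a b : R) n m :
  (loc_frac f (a : R^o) n : loc_ring) * (loc_frac f (b : R^o) m : loc_ring) =
  loc_frac f (a * b : R^o) (n + m).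
Proof. exact: loc_scale_frac. Qed.

Lemma loc_fracZ (M : lmodType R) (a : R) n (u : M) m :
  (loc_frac f (a : R^o) n : loc_ring) *: loc_frac f u m = loc_frac f (a *: u) (n + m).
Proof. exact: loc_scale_frac. Qed.

Definition loc_ring_of (a : R) : loc_ring := loc_frac f (a : R^o) 0.

End LocalizedRing.

(* Main.v *)
(* Each condition says that a linear map V -> W, where V and W are M or the     *)
(* degree p part of the Koszul complex, sends a submodule Z (colon module or    *)
(* cycles) into a submodule B (the ideal multiple of M, or boundaries).  All    *)
(* these submodules commute with localization, so an m that works over R works  *)
(* over R_f.  Conversely, enlarging m keeps the condition true, so one m works  *)
(* for all the R_(f_i); then w in the image of Z satisfies f_i^s w in B for     *)
(* every i and a common s, and the f_i^s generate the unit ideal.               *)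

Require Import Defs.
From mathcomp Require Import all_boot all_order all_algebra.
From mathcomp Require Import boolp classical_sets.

Set Implicit Arguments.
Unset Strict Implicit.
Unset Printing Implicit Defensive.

Import GRing.Theory.
Local Open Scope ring_scope.

(** A transition map between subquotients vanishes exactly when its underlying linear map carries a
    submodule [Z] into a submodule [B] ([subquot_map_eq0]). Here [Z] is a colon module or a module
    of Koszul cycles, and [B] is a module [seqmod] or one of Koszul boundaries. Kernels, images and
    colon modules by one element commute with localization, so over [R_f] the analogous submodules
    are the localizations of [Z] and [B]. For fixed [n] and [m] the inclusion therefore passes to
    [R_f] ([localized_sub]). It also descends from all the [R_(f_i)] ([localized_sub_covering]): the
    image of an element of [Z] is multiplied into [B] by a power of each [f_i], and equal powers of
    the [f_i] generate the unit ideal ([covering_sequence_exp]). The bound [m] found over [R_(f_i)]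
    depends on [i]. Transition maps compose, so a larger [m] still works, and finitely many bounds
    have a common one ([eventually_forall_ord]). *)

(** * Covering sequences and the unit ideal *)

Section Covering.
Local Open Scope classical_set_scope.
Variable R : comPzRingType.

Definition proper_ideal (I : set R) : Prop :=
  [/\ I 0, forall u v, I u -> I v -> I (u + v),
      forall a u, I u -> I (a * u) & ~ I 1].

(** By Zorn's lemma there is an ideal maximal among those containing [I] but not 1; maximality makes
    it prime. *)
Lemma proper_ideal_sub_prime (I : set R) : proper_ideal I ->
  exists2 P, prime_ideal P & I `<=` P.
Proof.
move=> [I0 ID IM I1].
(* The empty set is admitted because [Zorn_bigcup] includes empty chains. *)
pose Q (X : set R) := [/\ forall u v, X u -> X v -> X (u + v),
  forall a u, X u -> X (a * u), ~ X 1 & forall u, X u -> I `<=` X].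
have QI : Q I by split=> // u _.
have [F FQ Ftot|A [[AD AM A1 AI] Amax]] := @Zorn_bigcup R Q.
  split=> [u v [X FX Xu] [Y FY Yv]|a u [X FX Xu]|[X FX X1]|u [X FX Xu] w Iw].
  - have [XY|YX] := Ftot X Y FX FY.
      by exists Y => //; have [FD _ _ _] := FQ Y FY; apply: FD => //; apply: XY.
    by exists X => //; have [FD _ _ _] := FQ X FX; apply: FD => //; apply: YX.
  - by exists X => //; have [_ FM _ _] := FQ X FX; apply: FM.
  - by have [_ _ F1 _] := FQ X FX; apply: F1.
  - by exists X => //; have [_ _ _ H] := FQ X FX; apply: (H u).
have subIA : I `<=` A.
  have [[u Au]|An] := pselect (exists u, A u); first exact: AI Au.
  exfalso; apply: (Amax I) => //; split=> [u Au|IA].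
    by case: An; exists u.
  by apply: An; exists 0; apply: IA.
have adjoin u : ~ A u -> exists a r, A a /\ 1 = a + r * u.
  move=> nAu; apply: contrapT => nE.
  pose B : set R := fun w => exists a r, A a /\ w = a + r * u.
  have AB : A `<=` B.
    by move=> a Aa; exists a, 0; rewrite mul0r addr0.
  apply: (Amax B).
    split=> // BA; apply: nAu; apply: BA.
    by exists 0, 1; rewrite mul1r add0r; split=> //; apply: subIA.
  split=> [v w [a [r [Aa ->]]] [b [s [Ab ->]]]|c v [a [r [Aa ->]]]|//|_ _ w Iw].
  - by exists (a + b), (r + s); rewrite mulrDl addrACA; split=> //; apply: AD.
  - by exists (c * a), (c * r); rewrite mulrDr mulrA; split=> //; apply: AM.
  - exact/AB/subIA.
exists A => //; split=> // [|u v Auv]; first by split=> //; apply: subIA.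
have [|nAu] := pselect (A u); first by left.
have [|nAv] := pselect (A v); first by right.
have [a [r [Aa E]]] := adjoin u nAu; have [b [s [Ab F]]] := adjoin v nAv.
(* Expanding 1 = (a + ru)(b + sv), every term lies in [A], the last one because [u * v] does. *)
exfalso; apply: A1; rewrite -[1]mul1r {1}E F mulrDl; apply: (AD).
  by rewrite mulrC; apply: (AM).
rewrite mulrDr; apply: (AD); first exact: (AM).
by rewrite mulrACA; apply: (AM).
Qed.

(** Otherwise a prime contains all the [f i ^+ e], hence all the [f i], and lies in no
    [basic_open (f i)]. *)
Lemma covering_sequence_exp (r : nat) (f : 'I_r -> R) (e : nat) :
  covering_sequence f -> exists a : 'I_r -> R, \sum_i a i * f i ^+ e = 1.
Proof.
move=> fcov.
pose I : set R := fun u => exists a : 'I_r -> R, \sum_i a i * f i ^+ e = u.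
apply: contrapT => nI1.
have [|P primeP IP] := @proper_ideal_sub_prime I.
  split=> //.
  - by exists (fun=> 0); rewrite big1 // => i _; rewrite mul0r.
  - move=> _ _ [a <-] [b <-]; exists (fun i => a i + b i).
    by rewrite -big_split; apply: eq_bigr => i _; rewrite mulrDl.
  - move=> c _ [a <-]; exists (fun i => c * a i).
    by rewrite mulr_sumr; apply: eq_bigr => i _; rewrite mulrA.
have [_ _ P1 PM] := primeP.
have : Spec P by [].
rewrite fcov => -[i _ [_]]; apply; split=> //.
have : P (f i ^+ e).
  apply: IP; exists (fun j => (j == i)%:R).
  rewrite (bigD1 i) //= eqxx mul1r big1 ?addr0 // => j /negbTE->.
  by rewrite mul0r.
(* For exponent 0 the assumption reads [P 1], which is excluded. *)
by elim: e {I nI1 IP} => [//|e IH]; rewrite exprS => /PM[].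
Qed.

End Covering.

(** * Localization maps, and localization of submodules *)

Section LocRing.
Variables (R : comPzRingType) (f : R).
Local Notation iota := (loc_ring_of f).

Lemma loc_ring_ofM a b : iota (a * b) = iota a * iota b.
Proof. by rewrite /loc_ring_of loc_fracM. Qed.

Lemma loc_ring_ofX a n : iota (a ^+ n) = iota a ^+ n.
Proof. by elim: n => [//|n IH]; rewrite !exprS loc_ring_ofM IH. Qed.

Lemma loc_ring_of_exp_unit e : exists c, c * iota (f ^+ e) = 1.
Proof.
exists (loc_frac f (1 : R^o) e : loc_ring f).
rewrite /loc_ring_of loc_fracM; apply: loc_frac_eq.
by rewrite !expr0 scale1r mul1r addn0; symmetry; apply: mulr1.
Qed.

End LocRing.

(** These properties determine [V'] as the localization of [V], since [f] acts invertibly on any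
    [loc_ring f]-module. The abstract form also covers the Koszul modules of [loc f M], which are
    not of the form [loc f _]. *)
Record localization_map (R : comPzRingType) (f : R) (V : lmodType R)
    (V' : lmodType (loc_ring f)) (h : V -> V') : Prop := LocalizationMap {
  loc_mapD : {morph h : u v / u + v};
  loc_mapZ : forall a u, h (a *: u) = loc_ring_of f a *: h u;
  loc_map_ker : forall u, h u = 0 -> exists s, f ^+ s *: u = 0;
  loc_map_surj : forall v, exists e u, loc_ring_of f (f ^+ e) *: v = h u }.

(* For [h] a localization map and [N'] a submodule, this says that [N'] is the
   localization of the submodule [N]. *)
Definition localized_pred (R : comPzRingType) (f : R) (V : lmodType R)
    (V' : lmodType (loc_ring f)) (h : V -> V') (N : {pred V}) (N' : {pred V'}) :=
  forall u, h u \in N' <-> exists s, f ^+ s *: u \in N.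

Section LocalizationMap.
Variables (R : comPzRingType) (f : R) (V : lmodType R).
Variables (V' : lmodType (loc_ring f)) (h : V -> V').
Hypothesis h_loc : localization_map h.

Lemma loc_map0 : h 0 = 0.
Proof. by apply: (addIr (h 0)); rewrite -(loc_mapD h_loc) !add0r. Qed.

Lemma loc_map_sum (I : Type) (s : seq I) (P : pred I) (F : I -> V) :
  h (\sum_(i <- s | P i) F i) = \sum_(i <- s | P i) h (F i).
Proof. exact: (big_morph h (loc_mapD h_loc) loc_map0). Qed.

Lemma loc_map_eq u v : h u = h v -> exists s, f ^+ s *: u = f ^+ s *: v.
Proof.
move=> E; have [|s] := loc_map_ker h_loc (u := u - v).
  by apply: (addIr (h v)); rewrite -(loc_mapD h_loc) subrK add0r.
by rewrite scalerBr => /eqP; rewrite subr_eq0 => /eqP; exists s.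
Qed.

Lemma rpred_loc_expZ (N : submodClosed V') e v :
  loc_ring_of f (f ^+ e) *: v \in N -> v \in N.
Proof.
have [c cE] := loc_ring_of_exp_unit f e.
by move=> /(rpredZ c); rewrite scalerA cE scale1r.
Qed.

Lemma loc_map_common_denom (I : finType) (v : I -> V') :
  exists e (w : I -> V), forall i, loc_ring_of f (f ^+ e) *: v i = h (w i).
Proof.
have /fin_all_exists [e /fin_all_exists [w E]] i := loc_map_surj h_loc (v i).
pose m := \max_i e i.
exists m, (fun i => f ^+ (m - e i) *: w i) => i.
rewrite (loc_mapZ h_loc) -E scalerA -loc_ring_ofM -exprD subnK //.
exact: leq_bigmax.
Qed.

End LocalizationMap.

Section LocalizedKernelImage.
Variables (R : comPzRingType) (f : R).
Variables (V W : lmodType R) (V' W' : lmodType (loc_ring f)).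
Variables (h : V -> V') (hW : W -> W').
Hypotheses (h_loc : localization_map h) (hW_loc : localization_map hW).

Lemma localized_kernel (g : V -> W) (g' : V' -> W') :
    scalable g -> (forall u, g' (h u) = hW (g u)) ->
  localized_pred h (fun u => g u == 0) (fun v => g' v == 0).
Proof.
move=> gZ gE u; rewrite unfold_in gE; split=> [/eqP/(loc_map_ker hW_loc)|].
  by case=> s E; exists s; rewrite unfold_in gZ E.
case=> s; rewrite unfold_in gZ => /eqP E.
have [c cE] := loc_ring_of_exp_unit f s; apply/eqP.
rewrite -[LHS]scale1r -cE -scalerA -(loc_mapZ hW_loc) E.
by rewrite (loc_map0 hW_loc) scaler0.
Qed.

(** A preimage over [R_f] is cleared of its denominator by some [f ^+ e], and lifting the resulting
    equation from [W'] to [W] costs a further [f ^+ s]. The predicates here and in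
    [localized_kernel] are the bodies of [immod] and [kermod]. *)
Lemma localized_image (g : V -> W) (g' : V' -> W') :
    scalable g -> scalable g' -> (forall u, g' (h u) = hW (g u)) ->
  localized_pred hW (fun w => `[< exists v, w = g v >])
                    (fun w => `[< exists v, w = g' v >]).
Proof.
move=> gZ g'Z gE w; rewrite unfold_in; split=> [/asboolP [v' E]|].
  have [e [v vE]] := loc_map_surj h_loc v'.
  have : hW (f ^+ e *: w) = hW (g v).
    by rewrite (loc_mapZ hW_loc) E -g'Z vE gE.
  move=> /(loc_map_eq hW_loc) [s F].
  exists (s + e)%N; apply/asboolP; exists (f ^+ s *: v).
  by rewrite gZ -F scalerA exprD.
case=> s /asboolP [v E]; have [c cE] := loc_ring_of_exp_unit f s.
apply/asboolP; exists (c *: h v).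
by rewrite g'Z gE -E (loc_mapZ hW_loc) scalerA cE scale1r.
Qed.

End LocalizedKernelImage.

(** * Inclusions pass to localizations and descend from a covering *)

Section LocalGlobal.
Variable R : comPzRingType.
Variables (V W : lmodType R) (g : V -> W).
Hypothesis gZ : scalable g.
Variables (Z : {pred V}) (B : submodClosed W).

(** Up to the unit [f ^+ e], an element of [Z'] is the image of some [u] having a multiple
    [f ^+ s *: u] in [Z]. *)
Lemma localized_sub (f : R) (V' W' : lmodType (loc_ring f))
    (h : V -> V') (hW : W -> W') (g' : V' -> W')
    (Z' : submodClosed V') (B' : submodClosed W') :
    localization_map h -> localization_map hW -> scalable g' ->
    (forall u, g' (h u) = hW (g u)) ->
    localized_pred h Z Z' -> localized_pred hW B B' ->
  {in Z, forall u, g u \in B} -> {in Z', forall v, g' v \in B'}.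
Proof.
move=> h_loc hW_loc g'Z gE ZE BE gZB v vZ.
have [e [u uE]] := loc_map_surj h_loc v.
have /ZE [s suZ] : h u \in Z' by rewrite -uE rpredZ.
apply: (@rpred_loc_expZ _ _ _ _ e).
by rewrite -g'Z uE gE; apply/BE; exists s; rewrite -gZ gZB.
Qed.

(** With N the largest exponent, 1 is a combination of the [f i ^+ N], so [w] is a combination of
    elements of [B]. *)
Lemma covering_mem (r : nat) (f : 'I_r -> R) (w : W) : covering_sequence f ->
  (forall i, exists s, f i ^+ s *: w \in B) -> w \in B.
Proof.
move=> fcov /fin_all_exists [s sB].
have [a aE] := covering_sequence_exp (\max_i s i) fcov.
rewrite -[w]scale1r -aE scaler_suml rpred_sum // => i _.
rewrite -(subnK (leq_bigmax (F := s) i)) exprD mulrA -scalerA.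
by rewrite rpredZ // sB.
Qed.

Lemma localized_sub_covering (r : nat) (f : 'I_r -> R)
    (V' W' : forall i, lmodType (loc_ring (f i)))
    (h : forall i, V -> V' i) (hW : forall i, W -> W' i)
    (g' : forall i, V' i -> W' i)
    (Z' : forall i, {pred V' i}) (B' : forall i, {pred W' i}) :
    covering_sequence f ->
    (forall i u, g' i (h i u) = hW i (g u)) ->
    (forall i, localized_pred (h i) Z (Z' i)) ->
    (forall i, localized_pred (hW i) B (B' i)) ->
  (forall i, {in Z' i, forall v, g' i v \in B' i}) ->
  {in Z, forall u, g u \in B}.
Proof.
move=> fcov gE ZE BE gZB u uZ; apply: (covering_mem fcov) => i.
apply/BE; rewrite -gE; apply: gZB; apply/ZE.
by exists 0%N; rewrite expr0 scale1r.
Qed.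

End LocalGlobal.

(** Every class has a representative in [Z], and the class of its image is zero exactly when that
    image lies in [B']. *)
Lemma subquot_map_eq0 (R : pzRingType) (V W : lmodType R)
    (g : {linear V -> W}) (Z B : submodClosed V) (Z' B' : submodClosed W)
    (gZ : forall u, u \in Z -> g u \in Z')
    (gB : forall u, u \in B -> g u \in B') :
  (forall q, subquot_map gZ gB q = 0) <-> {in Z, forall u, g u \in B'}.
Proof.
have classE z : (subquot_map gZ gB (subquot_class B z) = 0) <->
                (g (val z) \in B').
  rewrite subquot_map_class -[0](raddf0 (quot_class (subin Z' B'))).
  by split=> [/quot_classP|H]; last apply/quot_classP; rewrite subr0.
split=> [q0 u uZ|gZB q].
  by have /classE := q0 (subquot_class B (Sub u uZ)); rewrite SubK.
have -> : q = subquot_class B (repr q) by symmetry; apply: quot_class_repr.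
exact/classE/gZB/valP.
Qed.

(** * Localizing colon modules and Koszul complexes *)

Section Instances.
Variables (R : comPzRingType) (f : R).
Local Notation iota := (loc_ring_of f).

Lemma loc_frac_localization (M : lmodType R) :
  localization_map (fun u : M => loc_frac f u 0 : loc f M).
Proof.
split=> [u v|a u|u /loc_fracP [s E]|].
- by rewrite loc_fracD !expr0 !scale1r.
- by rewrite loc_fracZ.
- by exists s; move: E; rewrite !expr0 !scale1r scaler0.
elim/loc_frac_ind => u n; exists n, u; rewrite loc_fracZ.
by apply: loc_frac_eq; rewrite !expr0 scale1r.
Qed.

Variables (M : lmodType R) (M' : lmodType (loc_ring f)) (h : M -> M').
Hypothesis h_loc : localization_map h.
Variable k : nat.

Section Proregular.
Variables (y : 'I_k -> R) (y' : 'I_k -> loc_ring f).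
Hypothesis yE : forall j, y' j = iota (y j).

(** The argument of [localized_image], with a common denominator for the finitely many
    coefficients. *)
Lemma localized_seqmod i : localized_pred h (seqmod y i) (seqmod y' i).
Proof.
move=> u; rewrite unfold_in; split=> [/asboolP [v' E]|].
  have [e [v vE]] := loc_map_common_denom h_loc v'.
  have /(loc_map_eq h_loc) [s F] :
      h (f ^+ e *: u) = h (\sum_(j < k | (j < i)%N) y j *: v j).
    rewrite (loc_mapZ h_loc) E (loc_map_sum h_loc) scaler_sumr.
    apply: eq_bigr => j _.
    by rewrite (loc_mapZ h_loc) -vE yE !scalerA mulrC.
  exists (s + e)%N; apply/asboolP; exists (fun j => f ^+ s *: v j).
  rewrite exprD -scalerA F scaler_sumr; apply: eq_bigr => j _.
  by rewrite !scalerA mulrC.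
case=> s /asboolP [v E]; have [c cE] := loc_ring_of_exp_unit f s.
apply/asboolP; exists (fun j => c *: h (v j)).
rewrite -[LHS]scale1r -cE -scalerA -(loc_mapZ h_loc) E (loc_map_sum h_loc).
rewrite scaler_sumr; apply: eq_bigr => j _.
by rewrite (loc_mapZ h_loc) yE !scalerA mulrC.
Qed.

Lemma localized_colonmod (N : submodClosed M) (N' : submodClosed M') a :
  localized_pred h N N' ->
  localized_pred h (colonmod N a) (colonmod N' (iota a)).
Proof.
move=> NE u; rewrite colonmodE -(loc_mapZ h_loc).
split=> [/NE|] [s]; rewrite ?colonmodE => sN.
  by exists s; rewrite colonmodE scalerA mulrC -scalerA.
by apply/NE; exists s; rewrite scalerA mulrC -scalerA.
Qed.

End Proregular.

Section Koszul.
Variable p : nat.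

Definition koszul_loc_map (u : koszul k M p) : koszul k M' p :=
  [ffun T => h (u T)].

(** Each degree is a finite direct sum of copies of [M], so one exponent serves all components. *)
Lemma koszul_loc_map_localization : localization_map koszul_loc_map.
Proof.
split=> [u v|a u|u /ffunP E|v].
- by apply/ffunP => T; rewrite !ffunE (loc_mapD h_loc).
- by apply/ffunP => T; rewrite !ffunE (loc_mapZ h_loc).
- have /fin_all_exists [s sE] T : exists s, f ^+ s *: u T = 0.
    by apply: (loc_map_ker h_loc); have := E T; rewrite !ffunE.
  exists (\max_T s T); apply/ffunP => T; rewrite !ffunE.
  rewrite -(subnK (leq_bigmax (F := s) T)) exprD -scalerA sE.
  exact: scaler0.
have [e [w wE]] := loc_map_common_denom h_loc v.
exists e, (finfun w : koszul k M p); apply/ffunP => T.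
by rewrite !ffunE wE.
Qed.

(** The right side is [koszul_loc_map] in degree [p.-1], unfolded because [p] is fixed in this
    section. *)
Lemma koszul_loc_map_diff (y : 'I_k -> R) (y' : 'I_k -> loc_ring f)
    (u : koszul k M p) : (forall j, y' j = iota (y j)) ->
  koszul_diff y' (koszul_loc_map u) =
  [ffun T => h (koszul_diff y u T)].
Proof.
move=> yE; apply/ffunP => S; rewrite !ffunE (loc_map_sum h_loc).
apply: eq_bigr => T _; rewrite (loc_map_sum h_loc); apply: eq_bigr => j _.
rewrite ffunE (loc_mapZ h_loc) yE loc_ring_ofM /koszul_sign.
congr (_ * _ *: _); rewrite loc_ring_ofX; congr (_ ^+ _).
(* What remains is that [iota] sends -1, the base of the signs, to -1. *)
exact: (loc_opp_frac f (1 : R^o) 0).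
Qed.

Lemma koszul_loc_map_koszul_map (c : 'I_k -> R) (c' : 'I_k -> loc_ring f)
    (u : koszul k M p) : (forall j, c' j = iota (c j)) ->
  koszul_map c' (koszul_loc_map u) = koszul_loc_map (koszul_map c u).
Proof.
move=> cE; apply/ffunP => T; rewrite !ffunE (loc_mapZ h_loc).
congr (_ *: _); rewrite (big_morph iota (@loc_ring_ofM _ f) (erefl _)).
by apply: eq_bigr.
Qed.

End Koszul.
End Instances.

(** * Vanishing of transition maps in terms of elements *)

Section Vanishing.
Variables (R : comPzRingType) (k : nat) (M : lmodType R) (x : 'I_k -> R).

Definition colon_vanishing (i : 'I_k) (n m : nat) : Prop :=
  {in colonmod (@seqmod R k M (powseq x m) i) (x i ^+ m),
    forall u, x i ^+ (m - n) *: u \in seqmod (powseq x n) i}.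

Definition koszul_vanishing (p n m : nat) : Prop :=
  {in @koszul_cycles R k M (powseq x m) p,
    forall u, koszul_map (powseq x (m - n)) u
                \in koszul_boundaries M (powseq x n) p}.

Lemma proregularP : proregular M x <->
  forall i n, (0 < n)%N -> exists m, (n <= m)%N /\ colon_vanishing i n m.
Proof.
split=> H i n /(H i) [m [le_nm nm0]]; exists m.
  by split=> //; apply: (subquot_map_eq0 _ (colon_mult_den le_nm)).1 nm0.
by exists le_nm; apply/subquot_map_eq0.
Qed.

Lemma weakly_proregularP : weakly_proregular M x <->
  forall p, (0 < p)%N -> forall n, (0 < n)%N ->
  exists m, (n <= m)%N /\ koszul_vanishing p n m.
Proof.
split=> H p p0 n /(H p p0) [m [le_nm nm0]]; exists m.
  split=> //; apply: (subquot_map_eq0 _ _).1 nm0 => u.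
  exact/koszul_map_boundaries/powseq_split.
by exists le_nm; apply/subquot_map_eq0.
Qed.

(** The transition map from level [m'] to level [n] factors through level [m]; the same holds for
    Koszul homology below. *)
Lemma colon_vanishing_mono i n m m' : (n <= m <= m')%N ->
  colon_vanishing i n m -> colon_vanishing i n m'.
Proof.
move=> /andP[le_nm le_mm'] nm0 u /(colon_mult_num le_mm') /nm0.
by rewrite scalerA -exprD addnC addnBA // subnK.
Qed.

Lemma koszul_vanishing_mono p n m m' : (n <= m <= m')%N ->
  koszul_vanishing p n m -> koszul_vanishing p n m'.
Proof.
move=> /andP[le_nm le_mm'] nm0 u.
move=> /(koszul_map_cycles (powseq_split x le_mm')) /nm0.
suff -> : koszul_map (powseq x (m - n)) (koszul_map (powseq x (m' - m)) u) =
          koszul_map (powseq x (m' - n)) u by [].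
apply/ffunP => T; rewrite !ffunE scalerA -big_split /=.
congr (_ *: _); apply: eq_bigr => j _.
by rewrite /powseq -exprD addnC addnBA // subnK.
Qed.

End Vanishing.

(** * Vanishing over the ring and over its localizations, for fixed [n] and [m] *)

Section VanishingLocalization.
Variables (R : comPzRingType) (k : nat) (M : lmodType R) (x : 'I_k -> R).
Local Notation x_ f := (fun j => loc_ring_of f (x j)).
Local Notation frac f := (fun u : M => loc_frac f u 0 : loc f M).
Local Notation koszul_frac f p := (@koszul_loc_map _ f M _ (frac f) k p).

Lemma powseq_loc_ring_of f n j :
  powseq (x_ f) n j = loc_ring_of f (powseq x n j).
Proof. by rewrite /powseq loc_ring_ofX. Qed.

Lemma localized_seqmod_loc f i m :
  localized_pred (frac f) (seqmod (powseq x m) i) (seqmod (powseq (x_ f) m) i).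
Proof.
apply: localized_seqmod; first exact: loc_frac_localization.
exact: powseq_loc_ring_of.
Qed.

Lemma localized_colonmod_loc f i m :
  localized_pred (frac f) (colonmod (seqmod (powseq x m) i) (x i ^+ m))
    (colonmod (seqmod (powseq (x_ f) m) i) (loc_ring_of f (x i) ^+ m)).
Proof.
rewrite -loc_ring_ofX; apply: localized_colonmod.
  exact: loc_frac_localization.
exact: localized_seqmod_loc.
Qed.

Lemma koszul_frac_localization f p : localization_map (koszul_frac f p).
Proof. exact/koszul_loc_map_localization/loc_frac_localization. Qed.

Lemma koszul_diff_frac f m p u :
  koszul_diff (powseq (x_ f) m) (koszul_frac f p u) =
  koszul_frac f p.-1 (koszul_diff (powseq x m) u).
Proof.
apply: koszul_loc_map_diff; first exact: loc_frac_localization.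
exact: powseq_loc_ring_of.
Qed.

Lemma localized_koszul_cycles f m p :
  localized_pred (koszul_frac f p) (koszul_cycles M (powseq x m) p)
    (koszul_cycles (loc f M) (powseq (x_ f) m) p).
Proof.
apply: (localized_kernel (koszul_frac_localization f p.-1)).
  by move=> a u; rewrite linearZ_LR.
exact: koszul_diff_frac.
Qed.

Lemma localized_koszul_boundaries f m p :
  localized_pred (koszul_frac f p) (koszul_boundaries M (powseq x m) p)
    (koszul_boundaries (loc f M) (powseq (x_ f) m) p).
Proof.
apply: (localized_image (koszul_frac_localization f p.+1)
                        (koszul_frac_localization f p)).
- by move=> a u; rewrite linearZ_LR.
- by move=> a u; rewrite linearZ_LR.
- exact: (@koszul_diff_frac f m p.+1).
Qed.

Lemma scale_frac f (i : 'I_k) n u :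
  loc_ring_of f (x i) ^+ n *: frac f u = frac f (x i ^+ n *: u).
Proof. by rewrite -loc_ring_ofX loc_fracZ. Qed.

Lemma koszul_map_frac f n p u :
  koszul_map (powseq (x_ f) n) (koszul_frac f p u) =
  koszul_frac f p (koszul_map (powseq x n) u).
Proof.
apply: koszul_loc_map_koszul_map; first exact: loc_frac_localization.
exact: powseq_loc_ring_of.
Qed.

Lemma scaler_scalable (A : comPzRingType) (V : lmodType A) (a : A) :
  scalable (fun u : V => a *: u).
Proof. by move=> b u; rewrite !scalerA mulrC. Qed.

Lemma colon_vanishing_loc f i n m : colon_vanishing M x i n m ->
  colon_vanishing (loc f M) (x_ f) i n m.
Proof.
apply: (localized_sub (scaler_scalable (x i ^+ (m - n)))
  (loc_frac_localization f M) (loc_frac_localization f M)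
  (scaler_scalable (loc_ring_of f (x i) ^+ (m - n)))).
- exact: scale_frac.
- exact: localized_colonmod_loc.
- exact: localized_seqmod_loc.
Qed.

Lemma koszul_vanishing_loc f p n m : koszul_vanishing M x p n m ->
  koszul_vanishing (loc f M) (x_ f) p n m.
Proof.
apply: (localized_sub _ (koszul_frac_localization f p)
                        (koszul_frac_localization f p)).
- by move=> a u; rewrite linearZ_LR.
- by move=> a u; rewrite linearZ_LR.
- exact: koszul_map_frac.
- exact: localized_koszul_cycles.
- exact: localized_koszul_boundaries.
Qed.

Variables (r : nat) (f : 'I_r -> R).
Hypothesis f_covering : covering_sequence f.

Lemma colon_vanishing_covering i n m :
  (forall l, colon_vanishing (loc (f l) M) (x_ (f l)) i n m) ->
  colon_vanishing M x i n m.
Proof.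
apply: (localized_sub_covering (f := f) (hW := fun l => frac (f l))
  (g' := fun l v => loc_ring_of (f l) (x i) ^+ (m - n) *: v)) => //.
- by move=> l u; apply: scale_frac.
- by move=> l; apply: localized_colonmod_loc.
- by move=> l; apply: localized_seqmod_loc.
Qed.

Lemma koszul_vanishing_covering p n m :
  (forall l, koszul_vanishing (loc (f l) M) (x_ (f l)) p n m) ->
  koszul_vanishing M x p n m.
Proof.
apply: (localized_sub_covering (f := f) (hW := fun l => koszul_frac (f l) p)
  (g' := fun l => koszul_map (powseq (x_ (f l)) (m - n)) (p := p))) => //.
- by move=> l u; apply: koszul_map_frac.
- by move=> l; apply: localized_koszul_cycles.
- by move=> l; apply: localized_koszul_boundaries.
Qed.

End VanishingLocalization.

(** * A common bound, and the two equivalences *)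

Lemma eventually_forall_ord (r : nat) (P : 'I_r -> nat -> Prop) (n : nat) :
    (forall i m m', (n <= m <= m')%N -> P i m -> P i m') ->
    (forall i, exists m, (n <= m)%N /\ P i m) ->
  exists m, (n <= m)%N /\ forall i, P i m.
Proof.
(* Taking the maximum with [n] keeps the bound valid when [r] is 0 and the big maximum is 0. *)
move=> Pmono /fin_all_exists [m mP]; exists (maxn n (\max_i m i)).
split=> [|i]; first exact: leq_maxl.
have [le_nm] := mP i; apply: Pmono; rewrite le_nm /=.
by rewrite leq_max leq_bigmax orbT.
Qed.

Theorem proposition4p2 (R : comPzRingType) (r : nat) (f : 'I_r -> R)
    (f_covering : covering_sequence f) (k : nat) (x : 'I_k -> R)
    (M : lmodType R) :
  (weakly_proregular M x <->
     forall i : 'I_r,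
       weakly_proregular (loc (f i) M) (fun j => loc_ring_of (f i) (x j)))
  /\
  (proregular M x <->
     forall i : 'I_r,
       proregular (loc (f i) M) (fun j => loc_ring_of (f i) (x j))).
Proof.
split; split.
- move=> /weakly_proregularP H l; apply/weakly_proregularP => p p0 n n0.
  have [m [le_nm nm0]] := H p p0 n n0.
  by exists m; split=> //; apply: koszul_vanishing_loc.
- move=> H; apply/weakly_proregularP => p p0 n n0.
  (* Descent compares all the localizations at the same [m], hence the uniform choice over [l]. *)
  have [l m m'||m [le_nm nm0]] := @eventually_forall_ord r (fun l m =>
    koszul_vanishing (loc (f l) M) (fun j => loc_ring_of (f l) (x j)) p n m) n.
  + exact: koszul_vanishing_mono.
  + by move=> l; have /weakly_proregularP := H l; apply.
  + by exists m; split=> //; apply: koszul_vanishing_covering nm0.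
- move=> /proregularP H l; apply/proregularP => i n n0.
  have [m [le_nm nm0]] := H i n n0.
  by exists m; split=> //; apply: colon_vanishing_loc.
- move=> H; apply/proregularP => i n n0.
  have [l m m'||m [le_nm nm0]] := @eventually_forall_ord r (fun l m =>
    colon_vanishing (loc (f l) M) (fun j => loc_ring_of (f l) (x j)) i n m) n.
  + exact: colon_vanishing_mono.
  + by move=> l; have /proregularP := H l; apply.
  + by exists m; split=> //; apply: colon_vanishing_covering nm0.
Qed.
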